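(* Let $r\ge1$, $p_1,\dots,p_r\in\mathbb{P}$, $N=p_1+\cdots+p_r$, and let $I_k$ denote the $k$-element chain. Let $M=\{1^{p_1},2^{p_2},\dots,r^{p_r}\}$ be the multiset with $p_i$ copies of $i$, let $\mathfrak{S}_M$ be the set of all words (multipermutations) $\pi=\pi_1\cdots\pi_N$ that are rearrangements of $M$, let $\mathrm{des}(\pi)=\#\{j<N:\pi_j>\pi_{j+1}\}$, and let $A_{M,r}(x)=\sum_{\pi\in\mathfrak{S}_M}x^{\mathrm{des}(\pi)}$. Then \[ \mathrm{Ehr}(\mathcal{O}(I_1\oplus(I_{p_1}+I_{p_2}+\cdots+I_{p_r})\oplus I_1),x)=\frac{A_{M,r}(x)}{(1-x)^{N+3}}. \]
   Context: For a finite poset $(P,\preceq)$ on $[p]$, the order polytope $\mathcal{O}(P)\subset\mathbb{R}^p$ is defined by $0\le x_i\le 1$ and $x_i\le x_j$ whenever $i\prec j$. For an integral polytope $\mathcal{Q}\subset\mathbb{R}^p$, $\mathrm{ehr}(\mathcal{Q},n)=|n\mathcal{Q}\cap\mathbb{Z}^p|$ ($n\ge1$), and $\mathrm{Ehr}(\mathcal{Q},x)=1+\sum_{n\ge1}\mathrm{ehr}(\mathcal{Q},n)x^n$. The direct sum $P_1+P_2$ is the disjoint union with no relations between $P_1$ and $P_2$; the ordinal sum $P_1\oplus P_2$ is the disjoint union keeping the orders of $P_1,P_2$ and declaring every element of $P_1$ below every element of $P_2$. *)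

(* Defs.v *)
From HB Require Import structures.
From mathcomp Require Import all_boot all_order all_algebra finmap.
From mathcomp Require Import boolp classical_sets cardinality reals.

Set Implicit Arguments.
Unset Strict Implicit.
Unset Printing Implicit Defensive.

Import Order.TTheory GRing.Theory Num.Theory.

(* Ring of formal power series: coefficient sequences with the Cauchy product.
   The units are the invertible series, so [f / g] is the usual quotient in
   R[[x]] whenever [g] is invertible (and, as for any MathComp unit ring, junk
   otherwise). *)
Section FormalPowerSeries.
Local Open Scope ring_scope.

Record fps (R : Type) := FPS { fps_coef : nat -> R }.

HB.instance Definition _ (R : Type) := [isNew for @fps_coef R].
HB.instance Definition _ (R : eqType) := [Equality of fps R by <:].
HB.instance Definition _ (R : choiceType) := [Choice of fps R by <:].

Lemma fpsP (R : Type) (f g : fps R) :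
  (forall n, fps_coef f n = fps_coef g n) -> f = g.
Proof. by move=> fg; apply: val_inj; apply/funext. Qed.

Variable R : comNzRingType.
Implicit Types f g h : fps R.

Definition fps_of_poly (p : {poly R}) : fps R := FPS (fun n => p`_n).

Definition fps_zero : fps R := FPS (fun=> 0).
Definition fps_opp f : fps R := FPS (fun n => - fps_coef f n).
Definition fps_add f g : fps R := FPS (fun n => fps_coef f n + fps_coef g n).
Definition fps_mul f g : fps R :=
  FPS (fun n => \sum_(i < n.+1) fps_coef f i * fps_coef g (n - i)%N).

Fact fps_addA : associative fps_add.
Proof. by move=> f g h; apply: fpsP => n /=; rewrite addrA. Qed.
Fact fps_addC : commutative fps_add.
Proof. by move=> f g; apply: fpsP => n /=; rewrite addrC. Qed.
Fact fps_add0 : left_id fps_zero fps_add.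
Proof. by move=> f; apply: fpsP => n /=; rewrite add0r. Qed.
Fact fps_addN : left_inverse fps_zero fps_opp fps_add.
Proof. by move=> f; apply: fpsP => n /=; rewrite addNr. Qed.

HB.instance Definition _ :=
  GRing.isZmodule.Build (fps R) fps_addA fps_addC fps_add0 fps_addN.

Definition fps_trunc m f : {poly R} := \poly_(i < m) fps_coef f i.

Lemma coef_fps_trunc m f n : (n < m)%N -> (fps_trunc m f)`_n = fps_coef f n.
Proof. by move=> nm; rewrite coef_poly nm. Qed.

Lemma fps_mul_trunc m f g n : (n < m)%N ->
  fps_coef (fps_mul f g) n = (fps_trunc m f * fps_trunc m g)`_n.
Proof.
move=> nm; rewrite coefM; apply: eq_bigr => i _.
rewrite !coef_fps_trunc //; first by rewrite (leq_ltn_trans (leq_subr _ _)).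
by rewrite (leq_ltn_trans _ nm) // -ltnS.
Qed.

Fact fps_mulC : commutative fps_mul.
Proof.
by move=> f g; apply: fpsP => n; rewrite !(fps_mul_trunc _ _ (ltnSn n)) mulrC.
Qed.

Fact fps_mulA : associative fps_mul.
Proof.
suff mulE f g h n : fps_coef (fps_mul (fps_mul f g) h) n =
    (fps_trunc n.+1 f * fps_trunc n.+1 g * fps_trunc n.+1 h)`_n.
  move=> f g h; apply: fpsP => n.
  by rewrite fps_mulC !mulE mulrC mulrA.
rewrite coefM; apply: eq_bigr => i _.
rewrite (fps_mul_trunc _ _ (ltn_ord i)) coef_fps_trunc //.
by rewrite ltnS leq_subr.
Qed.

Fact fps_mul1 : left_id (fps_of_poly 1) fps_mul.
Proof.
move=> f; apply: fpsP => n /=; rewrite big_ord_recl coef1 mul1r subn0.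
by rewrite big1 ?addr0 // => i _; rewrite coef1 mul0r.
Qed.

Fact fps_mulDl : left_distributive fps_mul fps_add.
Proof.
move=> f g h; apply: fpsP => n /=; rewrite -big_split /=.
by apply: eq_bigr => i _; rewrite mulrDl.
Qed.

Fact fps_oner_neq0 : fps_of_poly 1 != 0.
Proof.
apply/eqP => /(congr1 (fun f => fps_coef f 0%N)) /eqP /=.
by rewrite coef1 oner_eq0.
Qed.

HB.instance Definition _ := GRing.Zmodule_isComNzRing.Build (fps R)
  fps_mulA fps_mulC fps_mul1 fps_mulDl fps_oner_neq0.

Definition fps_unit : {pred fps R} := fun f => `[< exists g, g * f = 1 >].
Definition fps_inv f : fps R :=
  if pselect (exists g, g * f = 1) is left ex then sval (cid ex) else f.

Fact fps_mulVx : {in fps_unit, left_inverse 1 fps_inv *%R}.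
Proof.
by move=> f /asboolP ex; rewrite /fps_inv; case: pselect => // ?; case: cid.
Qed.
Fact fps_unitPl f g : g * f = 1 -> fps_unit f.
Proof. by move=> gf; apply/asboolP; exists g. Qed.
Fact fps_inv_out : {in [predC fps_unit], fps_inv =1 id}.
Proof.
by move=> f /asboolP nex; rewrite /fps_inv; case: pselect.
Qed.

HB.instance Definition _ := GRing.ComNzRing_hasMulInverse.Build (fps R)
  fps_mulVx fps_unitPl fps_inv_out.

Lemma fps_unit_1subX : fps_of_poly (1 - 'X) \is a GRing.unit.
Proof.
apply: (@fps_unitPl _ (FPS (fun=> 1))); rewrite mulrC; apply: fpsP => n /=.
have E k : (1 - 'X : {poly R})`_k = (k == 0%N)%:R - (k == 1%N)%:R.
  by rewrite coefB coef1 coefX.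
rewrite big_ord_recl /= !E subr0 mulr1; case: n => [|n].
  by rewrite big_ord0 addr0 coef1.
rewrite big_ord_recl /= E coef1 /= sub0r mulr1 big1 ?addr0 ?subrr // => i _.
by rewrite E subrr mul0r.
Qed.

End FormalPowerSeries.

(* [dsum P] is the direct sum of the family [P], on the disjoint union of its
   members. *)
Fact dsum_display : Order.disp_t. Proof. exact: Order.Disp tt tt. Qed.

Definition dsum (I : Type) (P : I -> Type) : Type := {i : I & P i}.

Section DirectSum.
Variables (d : Order.disp_t) (I : finType) (P : I -> finPOrderType d).

HB.instance Definition _ := Finite.on (dsum P).

Definition dsum_le (u v : dsum P) : bool :=
  (tag u == tag v) && (tagged u <= tagged_as u v)%O.

Fact dsum_le_refl : reflexive dsum_le.
Proof. by case=> i x; rewrite /dsum_le eqxx tagged_asE lexx. Qed.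

Fact dsum_le_anti : antisymmetric dsum_le.
Proof.
move=> [i x] [j y] /andP[/andP[/eqP/= ij]]; subst j.
rewrite /dsum_le !tagged_asE => xy /andP[_ yx].
by congr Tagged; apply/le_anti/andP.
Qed.

Fact dsum_le_trans : transitive dsum_le.
Proof.
move=> [j y] [i x] [k z] /andP[/eqP/= ij]; subst j.
rewrite tagged_asE => xy /andP[/eqP/= ik]; subst k.
rewrite tagged_asE => yz; rewrite /dsum_le eqxx tagged_asE.
exact: le_trans xy yz.
Qed.

HB.instance Definition _ := Order.Le_isPOrder.Build dsum_display (dsum P)
  dsum_le_refl dsum_le_anti dsum_le_trans.

End DirectSum.

Fact osum_display : Order.disp_t. Proof. exact: Order.Disp tt tt. Qed.

Definition osum (P Q : Type) : Type := (P + Q)%type.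

Section OrdinalSum.
Variables (d e : Order.disp_t) (P : finPOrderType d) (Q : finPOrderType e).

HB.instance Definition _ := Finite.on (osum P Q).

Definition osum_le (u v : osum P Q) : bool :=
  match u, v with
  | inl x, inl y => (x <= y)%O
  | inr x, inr y => (x <= y)%O
  | inl _, inr _ => true
  | inr _, inl _ => false
  end.

Fact osum_le_refl : reflexive osum_le.
Proof. by case=> x /=; rewrite lexx. Qed.

Fact osum_le_anti : antisymmetric osum_le.
Proof. by move=> [x|x] [y|y] //= /le_anti ->. Qed.

Fact osum_le_trans : transitive osum_le.
Proof. by move=> [y|y] [x|x] [z|z] //=; apply: le_trans. Qed.

HB.instance Definition _ := Order.Le_isPOrder.Build osum_display (osum P Q)
  osum_le_refl osum_le_anti osum_le_trans.

End OrdinalSum.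

Notation "P ⊕ Q" := (osum P Q) (at level 50, left associativity) : type_scope.

Section Ehrhart.
Local Open Scope classical_set_scope.
Local Open Scope ring_scope.

(* The coordinates of the ambient space are indexed by the elements of the
   poset, i.e. R^P = {ffun P -> R}. *)
Definition order_polytope (R : realType) d (P : finPOrderType d) :
    set {ffun P -> R} :=
  [set x | (forall i, 0 <= x i <= 1) /\
           (forall i j, (i < j)%O -> x i <= x j)].

#[global] Arguments order_polytope R {d} P.

Definition integer_points (R : realType) (T : finType) : set {ffun T -> R} :=
  [set x | forall t, x t \is a Num.int].

(* [fset_set] sends infinite sets to the empty one, so this is the number of
   lattice points of nQ for bounded Q only. *)
#[global] Arguments integer_points R T : clear implicits.

Definition ehr (R : realType) (T : finType) (Q : set {ffun T -> R})
    (n : nat) : nat :=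
  #|` fset_set ([set x *+ n | x in Q] `&` integer_points R T)|%fset.

Definition Ehr (R : realType) (T : finType) (Q : set {ffun T -> R}) : fps int :=
  FPS (fun n => if n is 0%N then 1 else (ehr Q n)%:Z).

End Ehrhart.

(* The multiset {1^{p_1}, ..., r^{p_r}}, listed in increasing order; the index
   k : 'I_r stands for the letter k + 1. *)
Definition multiset (r : nat) (p : 'I_r -> nat) : seq nat :=
  flatten [seq nseq (p k) k.+1 | k : 'I_r].

Definition des (w : seq nat) : nat :=
  #|[set j : 'I_(size w).-1 | nth 0 w j > nth 0 w j.+1]|.

(* [permutations] lists the distinct rearrangements of a sequence, each once. *)
Definition multiset_eulerian (M : seq nat) : {poly int} :=
  (\sum_(w <- permutations M) 'X^(des w))%R.

(* Main.v *)
(* Lattice points of the n-th dilate of the order polytope of P are the order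
   preserving maps P -> {0, ..., n}.  Adding a top or a bottom element replaces
   the sequence of their numbers by its partial sums, i.e. divides the
   generating function by 1 - x.  For a disjoint union of chains, such a map f
   is encoded by the lexicographically sorted list of the pairs (f u, letter
   of u): the second components form a word w of the multiset, and the first
   components are weakly increasing, with a strict increase at each descent
   of w.  For fixed w these value sequences are counted by the coefficients of
   x^(des w) / (1 - x)^(N + 1), which are the (N + 1)-fold partial sums of the
   sequence that is 1 at des w and 0 elsewhere; no binomial is needed. *)

Require Import Defs.
From mathcomp Require Import all_boot all_order all_algebra finmap zify.
From mathcomp Require Import classical_sets cardinality reals.

Set Implicit Arguments.
Unset Strict Implicit.
Unset Printing Implicit Defensive.

Import Order.TTheory GRing.Theory Num.Theory.

(** * Iterated partial sums and their generating functions *)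

Definition psum (h : nat -> nat) (n : nat) : nat := \sum_(u < n.+1) h u.

Lemma psumS h n : psum h n.+1 = psum h n + h n.+1.
Proof. by rewrite /psum big_ord_recr. Qed.

Lemma eq_psum h1 h2 : h1 =1 h2 -> psum h1 =1 psum h2.
Proof. by move=> eqh n; apply: eq_bigr => u _; apply: eqh. Qed.

Lemma eq_iter_psum k h1 h2 : h1 =1 h2 -> iter k psum h1 =1 iter k psum h2.
Proof. by move=> eqh; elim: k => //= k IHk; apply: eq_psum. Qed.

Lemma iter_psum_sum (T : Type) (s : seq T) (h : T -> nat -> nat) k n :
  iter k psum (fun m => \sum_(x <- s) h x m) n =
  \sum_(x <- s) iter k psum (h x) n.
Proof.
elim: k n => //= k IHk n.
by rewrite (eq_psum IHk) /psum exchange_big.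
Qed.

Lemma iter_psum_delta0 d k : iter k psum (fun m => d.+1 == m) 0 = 0.
Proof. by elim: k => //= k IHk; rewrite /psum big_ord1. Qed.

(** Partial sums commute with the shift of a sequence that starts with 0, and [iter_psum_delta0]
    keeps the start 0 at every stage. In [size_compat] this shift accounts for one descent. *)
Lemma iter_psum_deltaS d k n :
  iter k psum (fun m => d.+1 == m) n.+1 = iter k psum (fun m => d == m) n.
Proof.
elim: k n => //= k IHk n; rewrite /psum big_ord_recl /= iter_psum_delta0 add0n.
by apply: eq_bigr => i _; apply: IHk.
Qed.

(** Multiplication by $1-x$ takes successive differences, so each factor undoes one [psum]. *)
Lemma fps_psum (h : nat -> nat) (k : nat) :
  (FPS (fun n => (iter k psum h n)%:Z) * fps_of_poly (1 - 'X) ^+ k =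
   FPS (fun n => (h n)%:Z))%R.
Proof.
elim: k => [|k IHk]; first by rewrite expr0 mulr1.
rewrite exprS mulrA -[RHS]IHk; congr (_ * _)%R; apply: fpsP => n /=.
have E j : ((1 - 'X : {poly int})`_j = (j == 0%N)%:R - (j == 1%N)%:R)%R.
  by rewrite coefB coef1 coefX.
rewrite big_ord_recr /= subnn E /= subr0 mulr1.
case: n => [|n]; first by rewrite big_ord0 add0r /psum big_ord1.
rewrite big_ord_recr /= subSnn E /= sub0r mulrN1 big1 => [|i _].
  by rewrite psumS PoszD add0r addKr.
rewrite E; set j := (n.+1 - _)%N; have : (1 < j)%N.
  by rewrite /j /=; have := ltn_ord i; lia.
by case: j => [|[|j]] // _; rewrite subrr mulr0.
Qed.

Lemma card_fibers (T : finType) (n : nat) (A : {set T}) (g : T -> 'I_n) :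
  #|A| = \sum_(b < n) #|[set x in A | g x == b]|.
Proof.
rewrite -sum1_card (partition_big g predT) //=; apply: eq_bigr => b _.
by rewrite -sum1_card; apply: eq_bigl => x; rewrite inE.
Qed.

(** * Order preserving maps as lattice points of dilated order polytopes *)

Section OrderPreservingMaps.
Variables (d : Order.disp_t) (P : finPOrderType d).

Definition omaps (n : nat) : {set {ffun P -> 'I_n.+1}} :=
  [set f : {ffun P -> 'I_n.+1} |
    [forall x, forall y, (x <= y)%O ==> (f x <= f y)%N]].

Lemma omapsP n (f : {ffun P -> 'I_n.+1}) :
  reflect (forall x y, (x <= y)%O -> f x <= f y) (f \in omaps n).
Proof.
rewrite inE; apply: (iffP forallP) => [mf x y|mf x].
  by move/forallP: (mf x) => /(_ y) /implyP.
by apply/forallP => y; apply/implyP; apply: mf.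
Qed.

Lemma card_omaps0 : #|omaps 0| = 1.
Proof.
apply/eqP/cards1P; exists [ffun=> ord0]; apply/setP => f; rewrite inE.
apply/omapsP/eqP => [_|-> x y _]; last by rewrite !ffunE.
by apply/ffunP => x; rewrite ffunE ord1.
Qed.

Lemma Ehr_omaps (R : realType) :
  Ehr (order_polytope R P) = FPS (fun n => #|omaps n|%:Z%R).
Proof.
(* The constant term 1, set by convention in [Ehr], agrees with the single map into a one-element
   set. *)
apply: fpsP => -[|n] /=; first by rewrite card_omaps0.
congr Posz; rewrite /ehr.
pose emb (f : {ffun P -> 'I_n.+2}) : {ffun P -> R} := [ffun i => (f i)%:R%R].
have emb_inj : injective emb.
  move=> f g /ffunP fg; apply/ffunP => i; apply: val_inj.
  by move: (fg i); rewrite !ffunE => /eqP; rewrite eqr_nat => /eqP.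
(* Written as the image of a finite set, the set of lattice points is not subject to the empty
   default of [fset_set]. *)
rewrite (_ : (_ `&` _)%classic = [set` [fset emb f | f in omaps n.+1]%fset]%classic).
  by rewrite set_fsetK card_imfset //= -cardE.
have n0 : (0 < n.+1%:R :> R)%R by rewrite ltr0n.
apply/seteqP; split=> x /=.
- case=> -[y [y01 ymon] <-] xint.
  have xlt i : exists v : 'I_n.+2, ((y *+ n.+1)%R i = v%:R)%R.
    have yi := y01 i; have := xint i; rewrite ffunMnE => yint.
    have : (y i *+ n.+1 \is a Num.nat)%R.
      by rewrite natrEint yint mulrn_wge0 //; case/andP: yi.
    move=> /natrP[v Ev]; have lv : v < n.+2.
      rewrite ltnS -(ler_nat R) -Ev lerMn2r.
      by case/andP: yi => _ ->; rewrite orbT.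
    by exists (Ordinal lv).
  have [v Ev] := fin_all_exists xlt.
  apply/imfsetP; exists [ffun i => v i]; last first.
    by apply/ffunP => i; rewrite !ffunE -Ev ffunMnE.
  apply/omapsP => i j; rewrite le_eqVlt => /orP[/eqP->//|ij].
  rewrite !ffunE -(ler_nat R) -!Ev !ffunMnE lerMn2r.
  by rewrite ymon ?orbT.
- move=> /imfsetP[f /= /omapsP mf ->]; split; last by move=> i; rewrite /= ffunE natr_int.
  exists [ffun i => (f i)%:R / n.+1%:R]%R; last first.
    by apply/ffunP => i; rewrite ffunMnE !ffunE -[LHS]mulr_natr divfK // gt_eqF.
  split=> [i|i j ij]; rewrite !ffunE.
    by rewrite divr_ge0 //= ler_pdivrMr // mul1r ler_nat -ltnS ltn_ord.
  by rewrite ler_pM2r ?invr_gt0 // ler_nat mf // ltW.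
Qed.

End OrderPreservingMaps.

(** * Adding a top or a bottom element *)

Section AddExtremum.
Variables (d : Order.disp_t) (P : finPOrderType d).

(** Fibre over the value $b$ of the top element: the other values lie in $\{0,\dots,b\}$ and form an
    arbitrary element of [omaps P b]. *)
Lemma card_omaps_top n : #|omaps (P ⊕ 'I_1) n| = psum (fun m => #|omaps P m|) n.
Proof.
rewrite (card_fibers _
  (fun f : {ffun P ⊕ 'I_1 -> 'I_n.+1} => f (inr ord0))).
apply: eq_bigr => b _.
pose ext (f : {ffun P -> 'I_b.+1}) : {ffun P ⊕ 'I_1 -> 'I_n.+1} :=
  [ffun u => if u is inl x then inord (f x) else b].
have extE f x : ext f (inl x) = f x :> nat.
  rewrite ffunE inordK //; exact: leq_trans (ltn_ord _) (ltn_ord b).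
rewrite -(card_imset (f := ext)); last first.
  move=> f g fg; apply/ffunP => x; apply: val_inj => /=.
  by rewrite -!extE fg.
apply: eq_card => g; rewrite inE; apply/andP/imsetP.
- case=> /omapsP mg /eqP gb; exists [ffun x => inord (g (inl x))].
    apply/omapsP => x y xy; rewrite !ffunE !inordK ?mg //; rewrite ltnS -gb; exact: mg.
  apply/ffunP => -[x|x]; last by rewrite [x]ord1 gb ffunE.
  apply: val_inj => /=; rewrite extE ffunE inordK // ltnS -gb; exact: mg.
- case=> f /omapsP mf ->; split; last by rewrite ffunE.
  apply/omapsP => -[x|x] [y|y] //.
  + by rewrite !extE => /mf.
  + by rewrite extE ffunE -ltnS.
  + by rewrite !ffunE.
Qed.

(** The fibre index is $b = n - {}$the value of the bottom element. The other values then lie in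
    $\{n-b,\dots,n\}$, and subtracting $n-b$ moves them to $\{0,\dots,b\}$. *)
Lemma card_omaps_bottom n : #|omaps ('I_1 ⊕ P) n| = psum (fun m => #|omaps P m|) n.
Proof.
rewrite (card_fibers _
  (fun f : {ffun 'I_1 ⊕ P -> 'I_n.+1} => rev_ord (f (inl ord0)))).
apply: eq_bigr => b _.
pose ext (f : {ffun P -> 'I_b.+1}) : {ffun 'I_1 ⊕ P -> 'I_n.+1} :=
  [ffun u => if u is inr x then inord (n - b + f x) else rev_ord b].
have extE f x : ext f (inr x) = n - b + f x :> nat.
  rewrite ffunE inordK //; have := ltn_ord (f x); have := ltn_ord b; lia.
have extE0 f x : ext f (inl x) = n - b :> nat.
  by rewrite ffunE /= subSS.
rewrite -(card_imset (f := ext)); last first.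
  move=> f g fg; apply/ffunP => x; apply: val_inj => /=.
  by apply: (@addnI (n - b)); rewrite -!extE fg.
apply: eq_card => g; rewrite inE; apply/andP/imsetP.
- case=> /omapsP mg /eqP gb.
  have g0 : g (inl ord0) = n - b :> nat by rewrite -gb /= subSS subKn // -ltnS.
  have g_ge x : n - b <= g (inr x) by rewrite -g0 mg.
  have g_le x : g (inr x) - (n - b) < b.+1.
    by rewrite ltnS leq_subLR subnK -ltnS.
  exists [ffun x => inord (g (inr x) - (n - b))].
    by apply/omapsP => x y xy; rewrite !ffunE !inordK // leq_sub2r // mg.
  apply/ffunP => -[x|x]; apply: val_inj => /=.
    by rewrite [x]ord1 extE0 g0.
  by rewrite extE ffunE inordK // subnKC.
- case=> f /omapsP mf ->; split; last by rewrite ffunE rev_ordK.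
  apply/omapsP => -[x|x] [y|y] //.
  + by rewrite !extE0.
  + by rewrite extE extE0 leq_addr.
  + by rewrite !extE leq_add2l => /mf.
Qed.

End AddExtremum.

(** * Descents and the value sequences compatible with a word *)

Lemma des_seq1 x : des [:: x] = 0.
Proof. by apply: eq_card0 => -[]. Qed.

Lemma des_cons x y w : des [:: x, y & w] = (y < x) + des (y :: w).
Proof.
rewrite /des -!sum1_card big_mkcond big_ord_recl /= inE /=.
by congr (_ + _); rewrite [RHS]big_mkcond; apply: eq_bigr => i _; rewrite !inE.
Qed.

Lemma des_cons0 w : des (0 :: w) = des w.
Proof.
case: w => [|x w]; rewrite ?des_cons // des_seq1.
by apply/esym/eq_card0 => -[].
Qed.

Section CompatibleSequences.
Variable m : nat.
Implicit Types (y : 'I_m.+1 * nat) (t : seq ('I_m.+1 * nat)) (w M : seq nat).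

(** Consecutive pairs of a sorted list may share their first component only where the second
    components do not descend. *)
Definition lexle : rel ('I_m.+1 * nat) := fun x y =>
  (x.1 < y.1) || (x.1 == y.1 :> nat) && (x.2 <= y.2).

Lemma lexle_total : total lexle.
Proof. by move=> [a b] [c d]; rewrite /lexle /=; lia. Qed.

Lemma lexle_trans : transitive lexle.
Proof. by move=> [a b] [c d] [e f]; rewrite /lexle /=; lia. Qed.

Lemma lexle_anti : antisymmetric lexle.
Proof.
move=> [a b] [c d]; rewrite /lexle /= => H.
by have [ac ->] : a = c :> nat /\ b = d by [lia]; rewrite (val_inj ac).
Qed.

Lemma lexle0 y : lexle (ord0, 0) y.
Proof. by rewrite /lexle /=; case: (val y.1). Qed.

(** The argument [y] is the pair preceding the list; it bounds the first value as each later value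
    is bounded by its predecessor. *)
Fixpoint compat y w : seq (seq ('I_m.+1 * nat)) :=
  if w is x :: w' then
    [seq (v, x) :: t | v <- [seq v <- enum 'I_m.+1 | lexle y (v, x)],
                       t <- compat (v, x) w']
  else [:: [::]].

Lemma mem_compat y w t : (t \in compat y w) = path lexle y t && (unzip2 t == w).
Proof.
elim: w y t => [|x w IHw] y t /=.
  by rewrite inE; case: t => //= ? ?; rewrite andbF.
apply/allpairsPdep/andP => [[v [t' [vy]]]|].
  move: vy; rewrite mem_filter IHw => /andP[yv _] /andP[pt /eqP <-] -> /=.
  by rewrite yv.
case: t => [[]//|[v z] t] /= [/andP[yv pt] /eqP[zx tw]]; subst z.
exists v, t; split=> //; first by rewrite mem_filter yv mem_enum.
by rewrite IHw pt tw eqxx.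
Qed.

Lemma uniq_compat y w : uniq (compat y w).
Proof.
elim: w y => [|x w IHw] y //=; apply: allpairs_uniq_dep => //.
- by rewrite filter_uniq ?enum_uniq.
- by move=> [v t] [v' t'] _ _ /= [-> ->].
Qed.

Lemma sum_ord_ge (a : nat) (G : nat -> nat) :
  \sum_(v < m.+1 | a <= v) G (m - v) = if a <= m then psum G (m - a) else 0.
Proof.
rewrite (reindex_inj rev_ord_inj) /=; case: leqP => am.
  rewrite /psum (big_ord_widen m.+1 G); last by rewrite ltnS leq_subr.
  apply: eq_big => [u|u _]; first by have := ltn_ord u; lia.
  by congr G; have := ltn_ord u; lia.
by rewrite big_pred0 // => u; lia.
Qed.

(** Here $m - {}$[y.1] is the room left above the last value. Summing over the next value is one
    more partial sum; a descent forces that value up by one, which is the shift in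
    [iter_psum_deltaS]. *)
Lemma size_compat y w :
  size (compat y w) =
  iter (size w).+1 psum (fun j => des (y.2 :: w) == j) (m - y.1).
Proof.
elim: w y => [|x w IHw] y /=.
  by rewrite des_seq1 /psum big_ord_recl big1.
rewrite size_allpairs_dep sumnE big_map big_filter big_enum_cond /=.
under eq_bigr => v _ do rewrite IHw /=.
rewrite (eq_bigl (fun v : 'I_m.+1 => y.1 + (x < y.2) <= v)); last first.
  by move=> v; rewrite /lexle /=; case: ltnP; lia.
rewrite (sum_ord_ge _ (iter (size w).+1 psum (fun j => des (x :: w) == j))).
rewrite des_cons; case: ltnP => _ /=.
  (* At a descent with [y.1] equal to $m$ there is no room for a larger value, and both sides are
     0. *)
  rewrite addn1; have [ym|ym] := ltnP y.1 m.
    have -> : m - y.1 = (m - y.1.+1).+1 by lia.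
    exact/esym/(iter_psum_deltaS _ (size w).+2).
  have -> : m - y.1 = 0 by lia.
  exact/esym/(iter_psum_delta0 _ (size w).+2).
by rewrite addn0 -ltnS ltn_ord.
Qed.

Definition compat_seqs M : seq (seq ('I_m.+1 * nat)) :=
  [seq t | w <- permutations M, t <- compat (ord0, 0) w].

(** The starting pair [(ord0, 0)] is the least one for [lexle], so the path condition reduces to
    sortedness. *)
Lemma mem_compat_seqs M t :
  (t \in compat_seqs M) = sorted lexle t && perm_eq (unzip2 t) M.
Proof.
have path0 : path lexle (ord0, 0) t = sorted lexle t.
  by apply: path_min_sorted; apply/allP => y _; apply: lexle0.
apply/allpairsPdep/andP => [[w [t' [+ t'w tt']]]|[ts tM]].
  by move: t'w; rewrite -tt' mem_permutations mem_compat path0 => /andP[-> /eqP->].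
exists (unzip2 t), t; split=> //; first by rewrite mem_permutations.
by rewrite mem_compat path0 ts eqxx.
Qed.

Lemma uniq_compat_seqs M : uniq (compat_seqs M).
Proof.
apply: allpairs_uniq_dep; first exact: permutations_uniq.
  by move=> w _; apply: uniq_compat.
move=> _ _ /allpairsPdep[w [t [_ + ->]]] /allpairsPdep[w' [t' [_ + ->]]] /= tt'.
by rewrite !mem_compat {}tt' => /andP[_ /eqP<-] /andP[_ /eqP<-].
Qed.

Lemma size_compat_seqs M :
  size (compat_seqs M) =
  \sum_(w <- permutations M) iter (size M).+1 psum (fun j => des w == j) m.
Proof.
rewrite size_allpairs_dep sumnE big_map; apply: eq_big_seq => w.
rewrite mem_permutations => /perm_size <-.
by rewrite size_compat subn0 des_cons0.
Qed.

End CompatibleSequences.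

(** * Order preserving maps on a disjoint union of chains *)

Section SumOfChains.
Variables (r : nat) (p : 'I_r -> nat).
Local Notation D := (dsum (fun k : 'I_r => 'I_(p k))).

Lemma big_dsum (F : D -> nat) :
  \sum_(u : D) F u =
  \sum_k \sum_(i < p k) F (Tagged (fun k : 'I_r => 'I_(p k)) i).
Proof.
rewrite (sig_big_dep (fun=> true) (fun _ _ => true)
  (fun k i => F (Tagged (fun k : 'I_r => 'I_(p k)) i))).
by apply: eq_bigr => -[].
Qed.

Lemma count_multiset a :
  count a (multiset p) = \sum_k p k * a k.+1.
Proof.
rewrite count_flatten sumnE big_map big_image /=.
by apply: eq_bigr => k _; rewrite count_nseq mulnC.
Qed.

Lemma size_multiset : size (multiset p) = \sum_k p k.
Proof.
by rewrite -count_predT count_multiset; apply: eq_bigr => k _; rewrite muln1.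
Qed.

Variable m : nat.

Definition letters (f : {ffun D -> 'I_m.+1}) : seq ('I_m.+1 * nat) :=
  [seq (f u, (tag u).+1) | u <- enum {: D}].

Definition subword (t : seq ('I_m.+1 * nat)) (k : nat) : seq 'I_m.+1 :=
  [seq x.1 | x <- t & x.2 == k].

Lemma count_letters a f :
  count a (letters f) =
  \sum_k \sum_(i < p k) a (f (Tagged (fun k : 'I_r => 'I_(p k)) i), k.+1).
Proof.
by rewrite count_map -sum1_count big_enum_cond /= big_mkcond /= big_dsum;
  do 2![apply: eq_bigr => ? _]; case: (a _).
Qed.

Lemma perm_unzip2_letters f : perm_eq (unzip2 (letters f)) (multiset p).
Proof.
apply/permP => a; rewrite count_map count_letters count_multiset.
by apply: eq_bigr => k _; rewrite /= big_const_ord iter_addn_0 mulnC.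
Qed.

(** Sorting commutes with filtering, and on a chain the values of a monotone map are already sorted.
    Hence [f] can be read off its sorted list of pairs, which gives injectivity of the encoding. *)
Lemma subword_sort_letters f (k : 'I_r) : f \in omaps D m ->
  subword (sort (@lexle m) (letters f)) k.+1 =
  [seq f (Tagged (fun k : 'I_r => 'I_(p k)) i) | i <- enum 'I_(p k)].
Proof.
move=> /omapsP mf; pose s :=
  [seq (f (Tagged (fun k : 'I_r => 'I_(p k)) i), k.+1) | i <- enum 'I_(p k)].
rewrite /subword filter_sort; [|exact: lexle_total|exact: lexle_trans].
rewrite (_ : sort _ _ = s); first by rewrite -map_comp.
apply: (sorted_eq (@lexle_trans m) (@lexle_anti m)).
- exact/sort_sorted/lexle_total.
- apply: (@homo_sorted _ _ _ (fun i j : 'I_(p k) => i <= j)) => [i j ij|].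
    rewrite /lexle /= leqnn andbT orbC -leq_eqVlt; apply: mf.
    by rewrite /Order.le /= /dsum_le eqxx tagged_asE.
  by rewrite -sorted_map val_enum_ord iota_sorted.
- rewrite perm_sort; apply/permP => a; rewrite count_filter count_letters.
  rewrite (bigD1 k) //= [X in _ + X]big1 ?addn0 => [|j jk]; last first.
    by rewrite big1 // => i _; rewrite /= eqSS val_eqE (negPf jk) andbF.
  rewrite count_map -sum1_count big_enum_cond [RHS]big_mkcond /=.
  by apply: eq_bigr => i _; rewrite eqxx andbT; case: (a _).
Qed.

Lemma card_omaps_chains :
  #|omaps D m| = \sum_(w <- permutations (multiset p))
                   iter (\sum_k p k).+1 psum (fun j => des w == j) m.
Proof.
rewrite -size_multiset -size_compat_seqs cardE.
rewrite -(size_map (fun f => sort (@lexle m) (letters f))).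
apply/perm_size/uniq_perm; last 1 first.
- move=> t; rewrite mem_compat_seqs; apply/mapP/andP => [[f _ ->]|[ts tM]].
    rewrite sort_sorted; last exact: lexle_total.
    by rewrite (perm_trans _ (perm_unzip2_letters f)) // perm_map // perm_sort.
  pose f : {ffun D -> 'I_m.+1} :=
    [ffun u : D => nth ord0 (subword t (tag u).+1) (tagged u)].
  (* The multiplicity of each letter is the length of its chain, so the [nth] in [f] never returns
     its default. *)
  have size_subword (k : 'I_r) : size (subword t k.+1) = p k.
    rewrite size_map size_filter -(count_map _ (pred1 k.+1)).
    move/permP: tM => ->; rewrite count_multiset (bigD1 k) //= eqxx muln1.
    by rewrite big1 ?addn0 // => j jk; rewrite eqSS val_eqE (negPf jk) muln0.
  exists f.
    rewrite mem_enum; apply/omapsP => -[k i] [k' j] /andP[/eqP/= kk']; subst k'.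
    rewrite tagged_asE !ffunE /= => ij.
    apply: (@sorted_leq_nth _ (fun a b : 'I_m.+1 => a <= b)) => //.
    + by move=> ? ? ?; apply: leq_trans.
    (* Among pairs with the same letter, [lexle] is the order of the values. *)
    + apply: (@homo_sorted_in _ _ (fun x : 'I_m.+1 * nat => x.2 == k.+1) _ (@lexle m)).
      * move=> x y /eqP xk /eqP yk; rewrite /lexle xk yk leqnn andbT orbC.
        by rewrite -leq_eqVlt.
      * exact: filter_all.
      * exact: (sorted_filter (@lexle_trans m)).
    + by rewrite inE size_subword.
    + by rewrite inE size_subword.
  (* Both lists are sorted for an antisymmetric order, so it is enough that they have the same
     elements with multiplicity; these are counted letter by letter. *)
  apply: (sorted_eq (@lexle_trans m) (@lexle_anti m)) => //.
    exact/sort_sorted/lexle_total.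
  rewrite perm_sym perm_sort; apply/permP => a; rewrite count_letters.
  have -> : count a t = \sum_(k < r) count a [seq x <- t | x.2 == k.+1].
    rewrite -sum1_count [LHS]big_mkcond /=.
    under [RHS]eq_bigr => k _ do rewrite count_filter -sum1_count big_mkcond.
    rewrite exchange_big /=; apply: eq_big_seq => x xt.
    have : x.2 \in multiset p by rewrite -(perm_mem tM) map_f.
    move=> /flatten_mapP[k _ /nseqP[xk _]].
    rewrite (bigD1 k) //= xk eqxx andbT big1 ?addn0 // => j jk.
    by rewrite eqSS eq_sym val_eqE (negPf jk) andbF.
  apply: eq_bigr => k _.
  have -> : [seq x <- t | x.2 == k.+1] = [seq (v, k.+1) | v <- subword t k.+1].
    rewrite /subword -map_comp -[LHS]map_id; apply/eq_in_map => x.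
    by rewrite mem_filter => /andP[/eqP<- _] /=; case: x.
  rewrite count_map -sum1_count [RHS]big_mkcond (big_nth ord0) size_subword big_mkord.
  by apply: eq_bigr => i _; rewrite /= ffunE; case: (a _).
- rewrite map_inj_in_uniq ?enum_uniq // => f g; rewrite !mem_enum => mf mg fg.
  apply/ffunP => -[k i].
  have nthE h : h \in omaps D m ->
      nth ord0 (subword (sort (@lexle m) (letters h)) k.+1) i =
      h (Tagged (fun k : 'I_r => 'I_(p k)) i).
    move=> mh; rewrite subword_sort_letters // (nth_map i) ?size_enum_ord //.
    by rewrite nth_ord_enum.
  by rewrite -[LHS]nthE // -[RHS]nthE // fg.
- exact: uniq_compat_seqs.
Qed.

End SumOfChains.

Theorem theorem4p1 (R : realType) (r : nat) (p : 'I_r -> nat)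
    (hr : (1 <= r)%N) (hp : forall k : 'I_r, (0 < p k)%N) :
  (Ehr (order_polytope R ('I_1 ⊕ dsum (fun k : 'I_r => 'I_(p k)) ⊕ 'I_1))
   = fps_of_poly (multiset_eulerian (multiset p))
     / fps_of_poly (1 - 'X) ^+ (\sum_(k < r) p k + 3))%R.
Proof.
apply: (canRL (mulrK _)); first by rewrite unitrX ?fps_unit_1subX.
rewrite Ehr_omaps.
set N := \sum_(k < r) p k.
(* The numbers [h m] are the coefficients of the numerator: words with exactly $m$ descents. *)
pose h m := \sum_(w <- permutations (multiset p)) (des w == m).
have omapsE n :
    #|omaps ('I_1 ⊕ dsum (fun k : 'I_r => 'I_(p k)) ⊕ 'I_1) n| =
    iter (N + 3) psum h n.
  (* Of the $N+3$ partial sums, one comes from the top, one from the bottom and $N+1$ from the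
     chains. *)
  rewrite card_omaps_top addnC /= (eq_psum (card_omaps_bottom _)).
  do 2!apply: eq_psum => ?; rewrite card_omaps_chains.
  exact/esym/(iter_psum_sum _ (fun w m => des w == m) N.+1).
rewrite (_ : FPS _ = FPS (fun n => Posz (iter (N + 3) psum h n))); last first.
  by apply: fpsP => n /=; rewrite omapsE.
rewrite fps_psum; apply: fpsP => n /=.
rewrite /multiset_eulerian coef_sum /h -[Posz _]natz natr_sum.
by apply: eq_bigr => w _; rewrite coefXn eq_sym.
Qed.
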